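(* Let $M\in\mathbb{C}^{n\times n}$ and let $M=D+\Delta$ be a partition with $D$ diagonal having pairwise different diagonal entries, and let $G$ and $F$ be the associated inverse gaps matrix and map. If $$\|G\|\,\|\Delta\|<3-2\sqrt{2},$$ then the dynamical system defined by iterations of $F$ with initial condition $Z^{(0)}=I$ (that is, $Z^{(k)}=F(Z^{(k-1)})$ for $k\ge 1$) converges to a unique, asymptotically stable fixed point of $F$ in the ball $B_{\sqrt{2}}(I)$.
   Context: $\|\cdot\|$ is the spectral norm of a matrix (largest singular value). $I$ is the $n\times n$ identity matrix. $B_r(I)\subset\mathbb{C}^{n\times n}$ is the closed ball of radius $r$ centered at $I$ for $\|\cdot\|$. For a partition $M=D+\Delta$ with $D$ diagonal with pairwise different diagonal entries $D_{11},\dots,D_{nn}$ and $\Delta\in\mathbb{C}^{n\times n}$ the residual matrix, the inverse gaps matrix $G\in\mathbb{C}^{n\times n}$ is defined by $G_{jk}=(D_{jj}-D_{kk})^{-1}$ for $j\neq k$ and $G_{jj}=0$. The map $F:\mathbb{C}^{n\times n}\to\mathbb{C}^{n\times n}$ is $$F(Z)=I+G\circ\big(Z\,\mathcal{D}(\Delta Z)-\Delta Z\big),$$ where $\circ$ is the Hadamard (entrywise) product and $\mathcal{D}(X)$ is the diagonal matrix whose diagonal entries are those of $X$. *)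

(* Defs.v *)
From HB Require Import structures.
From mathcomp Require Export all_boot all_order all_algebra.
From mathcomp Require Export complex.
From mathcomp Require Export all_classical reals topology normedtype.

Set Implicit Arguments.
Unset Strict Implicit.
Unset Printing Implicit Defensive.

Export Order.TTheory GRing.Theory Num.Theory.
Export numFieldNormedType.Exports.

Global Open Scope classical_set_scope.
Global Open Scope complex_scope.
Global Open Scope ring_scope.

Local Open Scope sesquilinear_scope.

Section SpectralNorm.
Context {R : realType} {n : nat}.

(* The Hermitian matrix A^* A is unitarily diagonalizable, so that
   [spectral_diag (A^* A)] lists its eigenvalues with multiplicity; they are
   real and nonnegative, hence equal to their [complex.Re]. *)
Definition singular_value (A : 'M[R[i]]_n) (i : 'I_n) : R :=
  Num.sqrt (complex.Re (spectral_diag (A ^t* *m A) 0 i)).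

(* Singular values are nonnegative, so starting the maximum from 0 only
   matters for n = 0. *)
Definition specnorm (A : 'M[R[i]]_n) : R :=
  \big[Num.max/0]_(i < n) singular_value A i.

Definition specball (A : 'M[R[i]]_n) (r : R) : set 'M[R[i]]_n :=
  [set Z | specnorm (Z - A) <= r].

Definition mxcvg (Z : nat -> 'M[R[i]]_n) (L : 'M[R[i]]_n) : Prop :=
  (fun k => specnorm (Z k - L)) @ \oo --> (0 : R).

End SpectralNorm.

Section Stability.
Context {R : realType} {n : nat}.
Variable f : 'M[R[i]]_n -> 'M[R[i]]_n.

Definition lyapunov_stable (L : 'M[R[i]]_n) : Prop :=
  forall e : R, 0 < e -> exists2 d : R, 0 < d &
    forall Z, specnorm (Z - L) < d ->
      forall k : nat, specnorm (iter k f Z - L) < e.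

Definition locally_attractive (L : 'M[R[i]]_n) : Prop :=
  exists2 d : R, 0 < d &
    forall Z, specnorm (Z - L) < d -> mxcvg (fun k => iter k f Z) L.

Definition asymptotically_stable (L : 'M[R[i]]_n) : Prop :=
  lyapunov_stable L /\ locally_attractive L.

End Stability.

Section IterativeMap.
Context {K : fieldType} {n : nat}.

Definition hadamard (A B : 'M[K]_n) : 'M[K]_n := map2_mx *%R A B.

Definition diag_part (A : 'M[K]_n) : 'M[K]_n := diag_mx (\row_j A j j).

Definition inverse_gaps (D : 'M[K]_n) : 'M[K]_n :=
  \matrix_(j, k) if j == k then 0 else (D j j - D k k)^-1.

Definition iter_map (D Delta Z : 'M[K]_n) : 'M[K]_n :=
  1%:M + hadamard (inverse_gaps D) (Z *m diag_part (Delta *m Z) - Delta *m Z).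

End IterativeMap.

(* Main.v *)
Require Import Defs.
From mathcomp Require Import sequences.
From mathcomp Require Import ring lra.

(** Write [eps = |G| |Delta|].  Schur's inequality [|A o B| <= |A| |B|] bounds
    [|F Z - I|] by [eps (1 + r) (2 + r)] on the ball of radius [r] around [I],
    and [F] is there [eps (3 + 2 r)]-Lipschitz.  For [r = sqrt 2] one has
    [(3 - 2 r) (1 + r) (2 + r) = r] and [(3 - 2 r) (3 + 2 r) = 1], so [F] is a
    contraction mapping the closed ball into a strictly smaller one; Banach's
    argument applies, and the fixed point has a neighbourhood inside the ball. *)

Local Open Scope sesquilinear_scope.

Local Notation normc := ComplexField.Normc.normc.

(** * Squared Euclidean norm of complex column vectors *)

Section SquaredNorm.
Context {R : realType}.

(** The modulus is the real-valued [normc], so that all estimates take place in the ordered field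
    [R] and not in [R[i]]. *)
Definition sqnorm {n} (v : 'cV[R[i]]_n) : R := \sum_i normc (v i 0) ^+ 2.

Lemma normr_normc (z : R[i]) : `|z| = (normc z)%:C.
Proof. by case: z => a b; rewrite normc_def. Qed.

Lemma normc_ge0 (z : R[i]) : 0 <= normc z.
Proof. by case: z => a b; exact: sqrtr_ge0. Qed.

Lemma sqnorm_ge0 {n} (v : 'cV[R[i]]_n) : 0 <= sqnorm v.
Proof. by apply: sumr_ge0 => i _; rewrite sqr_ge0. Qed.

Lemma sqnorm_coord {n} (v : 'cV[R[i]]_n) i : normc (v i 0) ^+ 2 <= sqnorm v.
Proof.
by rewrite /sqnorm (bigD1 i) //= lerDl sumr_ge0 // => j _; rewrite sqr_ge0.
Qed.

Lemma sqnormE {n} (v : 'cV[R[i]]_n) : (sqnorm v)%:C = (v ^t* *m v) 0 0.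
Proof.
rewrite mxE rmorph_sum; apply: eq_bigr => i _.
by rewrite !mxE rmorphXn /= -normr_normc normCKC.
Qed.

Lemma sqnorm_unitary {n} (U : 'M[R[i]]_n) v :
  U \is unitarymx -> sqnorm (U *m v) = sqnorm v.
Proof.
move=> Uu; apply: (@complexI R); rewrite !sqnormE.
rewrite trmx_mul map_mxM -mulmxA (mulmxA (U ^t*)).
have -> : U ^t* *m U = 1%:M; last by rewrite mul1mx.
by rewrite -{2}(trmxCK U); apply/unitarymxP; rewrite trmxC_unitary.
Qed.

Lemma sqnorm_delta {n} (i : 'I_n) : sqnorm (delta_mx i 0 : 'cV[R[i]]_n) = 1.
Proof.
rewrite /sqnorm (bigD1 i) //= big1 => [|j jni]; last first.
  by rewrite mxE (negPf jni) ComplexField.Normc.normc0 expr0n.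
by rewrite mxE !eqxx ComplexField.Normc.normc1 expr1n addr0.
Qed.

(** A weighted substitute for Cauchy-Schwarz in the triangle inequality: once [|x + y|] is bounded
    by [|x| + |y|], the two sides differ in each coordinate by the square of [b |x| - a |y|]. *)
Lemma sqnormD {n} (a b : R) (u v : 'cV[R[i]]_n) : 0 <= a -> 0 <= b ->
  a * b * sqnorm (u + v) <= (a + b) * (b * sqnorm u + a * sqnorm v).
Proof.
move=> a0 b0; rewrite /sqnorm !mulr_sumr -big_split /= mulr_sumr.
apply: ler_sum => i _; rewrite mxE.
set x := u i 0; set y := v i 0.
have xy : normc (x + y) ^+ 2 <= (normc x + normc y) ^+ 2.
  by rewrite lerXn2r ?nnegrE ?addr_ge0 ?normc_ge0 // le_normcD.
apply: le_trans (ler_wpM2l (mulr_ge0 a0 b0) xy) _.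
rewrite -subr_ge0.
have -> : (a + b) * (b * normc x ^+ 2 + a * normc y ^+ 2)
   - a * b * (normc x + normc y) ^+ 2 = (b * normc x - a * normc y) ^+ 2 by ring.
exact: sqr_ge0.
Qed.

End SquaredNorm.

(** * The spectral norm as an operator norm, and Schur's inequality *)

Section SpectralNorm.
Context {R : realType} {n : nat}.
Implicit Types (A B X Z : 'M[R[i]]_n) (v : 'cV[R[i]]_n) (c : R).

Lemma singular_decomposition A : exists2 U : 'M[R[i]]_n, U \is unitarymx &
  A ^t* *m A = U ^t* *m diag_mx (spectral_diag (A ^t* *m A)) *m U.
Proof.
have nA : A ^t* *m A \is normalmx.
  by apply/normalmxP; rewrite trmx_mul map_mxM trmxCK.
exists (spectralmx (A ^t* *m A)); first exact: spectral_unitarymx.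
rewrite -(invmx_unitary (spectral_unitarymx _)); exact/orthomx_spectralP.
Qed.

(** Diagonalizing [A^* A] in [v^* A^* A v] gives the sum. It is stated in [R[i]] because the
    eigenvalues are not yet known to be real. *)
Lemma sqnorm_spectral_diag A : exists2 U : 'M[R[i]]_n, U \is unitarymx &
  forall v, (sqnorm (A *m v))%:C =
    \sum_i spectral_diag (A ^t* *m A) 0 i * (normc ((U *m v) i 0) ^+ 2)%:C.
Proof.
have [U Uu AA] := singular_decomposition A.
exists U => // v; rewrite sqnormE trmx_mul map_mxM.
rewrite -mulmxA (mulmxA (A ^t*)) [in LHS]AA -!mulmxA mulmxA -map_mxM -trmx_mul.
rewrite mxE; apply: eq_bigr => i _.
rewrite mul_diag_mx !mxE rmorphXn /= -normr_normc normCKC.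
by rewrite mulrCA.
Qed.

(** Evaluating the quadratic form at [U^* e_i] isolates the eigenvalue as a squared norm, hence real
    and nonnegative; [complex.Re] and [Num.sqrt] then lose nothing. *)
Lemma spectral_diag_singular A i :
  spectral_diag (A ^t* *m A) 0 i = (singular_value A i ^+ 2)%:C.
Proof.
have [U Uu AE] := sqnorm_spectral_diag A.
have := AE (U ^t* *m delta_mx i 0).
rewrite (mulmxA U) (unitarymxP Uu) mul1mx (bigD1 i) //= big1 => [|j ji]; last first.
  by rewrite mxE (negPf ji) ComplexField.Normc.normc0 expr0n mulr0.
rewrite mxE !eqxx ComplexField.Normc.normc1 expr1n mulr1 addr0 => E.
by rewrite /singular_value -E /= sqr_sqrtr ?sqnorm_ge0.
Qed.

Lemma sqnorm_singular A : exists2 U : 'M[R[i]]_n, U \is unitarymx &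
  forall v, sqnorm (A *m v) =
    \sum_i singular_value A i ^+ 2 * normc ((U *m v) i 0) ^+ 2.
Proof.
have [U Uu AE] := sqnorm_spectral_diag A; exists U => // v.
apply: (@complexI R); rewrite AE rmorph_sum; apply: eq_bigr => i _.
by rewrite spectral_diag_singular -rmorphM.
Qed.

Lemma specnorm_ge0 A : 0 <= specnorm A.
Proof. exact: bigmax_ge_id. Qed.

(** The link between singular values and the action on vectors, from which the norm properties below
    follow. Each weight in [sqnorm_singular] is at most the squared maximum; conversely [U^* e_i]
    turns the vector bound into a bound on the singular value of index [i]. *)
Lemma specnorm_leP A c : 0 <= c ->
  specnorm A <= c <-> forall v, sqnorm (A *m v) <= c ^+ 2 * sqnorm v.
Proof.
move=> c0; split=> [Ac v|Ac].
  have [U Uu ->] := sqnorm_singular A.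
  rewrite -(sqnorm_unitary _ v Uu) /sqnorm mulr_sumr; apply: ler_sum => i _.
  rewrite ler_wpM2r ?sqr_ge0 // lerXn2r ?nnegrE ?sqrtr_ge0 //.
  by apply: le_trans Ac; apply: le_bigmax.
apply: bigmax_le => // i _.
have [U Uu AE] := sqnorm_singular A.
have := Ac (U ^t* *m delta_mx i 0); rewrite AE -(sqnorm_unitary _ _ Uu).
rewrite (mulmxA U) (unitarymxP Uu) mul1mx sqnorm_delta mulr1 (bigD1 i) //= big1.
  rewrite mxE !eqxx ComplexField.Normc.normc1 expr1n mulr1 addr0.
  by rewrite ler_pXn2r ?nnegrE ?sqrtr_ge0.
by move=> j ji; rewrite mxE (negPf ji) ComplexField.Normc.normc0 expr0n mulr0.
Qed.

Lemma sqnorm_mulmx A v : sqnorm (A *m v) <= specnorm A ^+ 2 * sqnorm v.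
Proof. by move: v; apply/specnorm_leP => //; exact: specnorm_ge0. Qed.

Lemma sqnorm_col A k : sqnorm (col k A) <= specnorm A ^+ 2.
Proof. by rewrite colE (le_trans (sqnorm_mulmx _ _)) // sqnorm_delta mulr1. Qed.

Lemma normc_entry A j k : normc (A j k) <= specnorm A.
Proof.
rewrite -(@ler_pXn2r _ 2) ?nnegrE ?normc_ge0 ?specnorm_ge0 //.
apply: le_trans (sqnorm_col A k); apply: le_trans (sqnorm_coord _ j).
by rewrite mxE.
Qed.

Lemma specnormM A B : specnorm (A *m B) <= specnorm A * specnorm B.
Proof.
apply/specnorm_leP => [|v]; first by rewrite mulr_ge0 ?specnorm_ge0.
rewrite -mulmxA (le_trans (sqnorm_mulmx _ _)) // exprMn -[leRHS]mulrA.
by rewrite ler_wpM2l ?sqr_ge0 // sqnorm_mulmx.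
Qed.

Lemma specnormN A : specnorm (- A) = specnorm A.
Proof.
rewrite /specnorm /singular_value.
have -> : (- A) ^t* = - A ^t* by apply/matrixP => j k; rewrite !mxE rmorphN.
by rewrite mulNmx mulmxN opprK.
Qed.

Lemma specnorm0 : specnorm (0 : 'M[R[i]]_n) = 0.
Proof.
apply/eqP; rewrite eq_le specnorm_ge0 andbT; apply/specnorm_leP => // v.
by rewrite mul0mx expr0n mul0r /sqnorm big1 // => i _;
   rewrite mxE ComplexField.Normc.normc0 expr0n.
Qed.

Lemma specnorm_eq0 A : specnorm A <= 0 -> A = 0.
Proof.
move=> A0; apply/matrixP => j k; rewrite mxE.
apply: ComplexField.Normc.eq0_normc; apply/eqP.
by rewrite eq_le normc_ge0 andbT (le_trans (normc_entry _ _ _)).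
Qed.

Lemma specnorm1 : specnorm (1%:M : 'M[R[i]]_n) <= 1.
Proof. by apply/specnorm_leP => // v; rewrite mul1mx expr1n mul1r. Qed.

Lemma specnormD A B : specnorm (A + B) <= specnorm A + specnorm B.
Proof.
have [A0|A0] := leP (specnorm A) 0.
  by rewrite (specnorm_eq0 _ A0) add0r specnorm0 add0r.
have [B0|B0] := leP (specnorm B) 0.
  by rewrite (specnorm_eq0 _ B0) addr0 specnorm0 addr0.
apply/specnorm_leP => [|v]; first by rewrite addr_ge0 ?specnorm_ge0.
have [a0 b0] := (ltW A0, ltW B0).
(* With [a = |A|] and [b = |B|], [sqnormD] yields exactly [a b (a + b)^2 |v|^2]. Cancelling [a b]
   requires both norms to be positive, whence the two cases above. *)
rewrite -(ler_pM2l (mulr_gt0 A0 B0)) mulmxDl.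
apply: le_trans (sqnormD _ _ _ _ a0 b0) _.
set a := specnorm A in a0 *; set b := specnorm B in b0 *.
have Av := ler_wpM2l b0 (sqnorm_mulmx A v).
have Bv := ler_wpM2l a0 (sqnorm_mulmx B v).
apply: le_trans (ler_wpM2l (addr_ge0 a0 b0) (lerD Av Bv)) _.
by rewrite -/a -/b le_eqVlt; apply/orP; left; apply/eqP; ring.
Qed.

Lemma specnormB A B : specnorm (A - B) <= specnorm A + specnorm B.
Proof. by rewrite -(specnormN B) specnormD. Qed.

Lemma specnorm_sub A B : specnorm (A - B) = specnorm (B - A).
Proof. by rewrite -specnormN opprB. Qed.

Lemma specnorm_triangle B A Z :
  specnorm (A - Z) <= specnorm (A - B) + specnorm (B - Z).
Proof. by rewrite -{1}(subrK B A) -addrA specnormD. Qed.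

(** A diagonal matrix scales coordinates, and each diagonal entry is bounded by the norm. *)
Lemma specnorm_diag_part A : specnorm (diag_part A) <= specnorm A.
Proof.
apply/specnorm_leP => [|v]; first exact: specnorm_ge0.
rewrite /sqnorm mulr_sumr; apply: ler_sum => j _.
rewrite mul_diag_mx !mxE ComplexField.Normc.normcM exprMn ler_wpM2r ?sqr_ge0 //.
by rewrite lerXn2r ?nnegrE ?normc_ge0 ?specnorm_ge0 // normc_entry.
Qed.

(* Row j of [hadamard A B *m v] is row j of [A *m w j], where [w j] is row j of
   [B] scaled entrywise by [v]; the column norms of [B] are at most [specnorm B]. *)
Lemma specnorm_hadamard A B : specnorm (hadamard A B) <= specnorm A * specnorm B.
Proof.
apply/specnorm_leP => [|v]; first by rewrite mulr_ge0 ?specnorm_ge0.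
pose w j : 'cV[R[i]]_n := \col_k (B j k * v k 0).
have rowE j : (hadamard A B *m v) j 0 = (A *m w j) j 0.
  by rewrite !mxE; apply: eq_bigr => k _; rewrite !mxE mulrA.
apply: (@le_trans _ _ (\sum_j specnorm A ^+ 2 * sqnorm (w j))).
  apply: ler_sum => j _; rewrite rowE.
  exact: le_trans (sqnorm_coord _ j) (sqnorm_mulmx _ _).
rewrite -mulr_sumr exprMn -[leRHS]mulrA ler_wpM2l ?sqr_ge0 //.
rewrite /sqnorm exchange_big mulr_sumr; apply: ler_sum => k _ /=.
apply: (@le_trans _ _ (sqnorm (col k B) * normc (v k 0) ^+ 2)).
  rewrite /sqnorm mulr_suml; apply: ler_sum => j _.
  by rewrite !mxE ComplexField.Normc.normcM exprMn.
by rewrite ler_wpM2r ?sqr_ge0 // sqnorm_col.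
Qed.

Lemma specnorm_scale_delta (c : R[i]) j k :
  specnorm (c *: delta_mx j k : 'M[R[i]]_n) <= normc c.
Proof.
apply/specnorm_leP => [|v]; first exact: normc_ge0.
have E : c *: delta_mx j k *m v = (c * v k 0) *: delta_mx j 0.
  apply/matrixP => i l; rewrite !mxE (bigD1 k) //= big1 => [|m mk].
    by rewrite ord1 !mxE !eqxx andbT addr0; case: (i == j); rewrite ?(mulr1, mulr0, mul0r).
  by rewrite !mxE (negPf mk) andbF mulr0 mul0r.
rewrite E; have -> : sqnorm ((c * v k 0) *: delta_mx j 0 : 'cV_n) = normc (c * v k 0) ^+ 2.
  rewrite -[RHS]mulr1 -(sqnorm_delta j) /sqnorm mulr_sumr.
  by apply: eq_bigr => i _; rewrite !mxE ComplexField.Normc.normcM exprMn.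
rewrite ComplexField.Normc.normcM exprMn ler_wpM2l ?sqr_ge0 //.
exact: sqnorm_coord.
Qed.

(** Together with [normc_entry], this reduces convergence in spectral norm to convergence of the
    entries. *)
Lemma specnorm_sum_entries A : specnorm A <= \sum_j \sum_k normc (A j k).
Proof.
have sumD (I : finType) (F : I -> 'M[R[i]]_n) :
    specnorm (\sum_i F i) <= \sum_i specnorm (F i).
  apply: (big_ind2 (fun X x => specnorm X <= x)) => [|X x Y y Xx Yy|//].
    by rewrite specnorm0.
  by apply: le_trans (specnormD _ _) _; exact: lerD.
rewrite {1}(matrix_sum_delta A) (le_trans (sumD _ _)) //.
apply: ler_sum => j _; apply: (le_trans (sumD _ _)).
by apply: ler_sum => k _; exact: specnorm_scale_delta.
Qed.

End SpectralNorm.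

(** * Completeness of the matrix space for the spectral norm *)

Section Completeness.
Context {R : realType}.

Lemma geometric_increments_cvg (a : R^nat) (C q : R) : 0 <= q < 1 ->
  (forall k, `|a k.+1 - a k| <= C * q ^+ k) -> cvgn a.
Proof.
move=> /andP[q0 q1] aC.
have cs : cvgn (series (telescope a)).
  apply: normed_cvg.
  apply: (@series_le_cvg _ _ (geometric C q)) => [k|k|k|].
  - exact: normr_ge0.
  - exact: le_trans (normr_ge0 _) (aC k).
  - exact: aC.
  - by apply: is_cvg_geometric_series; rewrite ger0_norm.
(* The partial sums are [a k - a 0]; the initial value is added back. *)
have -> : a = series (telescope a) \+ cst (a 0%N).
  by rewrite telescopeK; apply/funext => k /=; rewrite subrK.
by apply: is_cvgD => //; exact: is_cvg_cst.
Qed.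

(** Serves to show that a limit [L] of iterates is fixed: [c] will be the norm of [f L - L] and
    [u k] the distance from the iterate of index [k] to [L]. *)
Lemma le_cvg0_le0 (u : R^nat) (c q : R) : u @ \oo --> (0 : R) ->
  (forall k, c <= q * u k + u k.+1) -> c <= 0.
Proof.
move=> u0 cu.
have lim : (fun k => q * u k + u k.+1) @ \oo --> q * 0 + (0 : R).
  by apply: cvgD; [apply: cvgMr|rewrite (cvg_shiftS u)].
rewrite mulr0 addr0 in lim; rewrite -(cvg_lim _ lim) //.
by apply: limr_ge; [apply/cvg_ex; exists 0|exact: nearW].
Qed.

Lemma normc_le (z : R[i]) : normc z <= `|complex.Re z| + `|complex.Im z|.
Proof.
case: z => a b /=; rewrite -[leRHS]ger0_norm ?addr_ge0 // -sqrtr_sqr.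
by rewrite ler_wsqrtr // sqrrD !real_normK ?num_real // addrAC lerDl mulrn_wge0 // mulr_ge0.
Qed.

Lemma normc_ge_absRe (z : R[i]) : `|complex.Re z| <= normc z.
Proof.
by case: z => a b /=; rewrite -sqrtr_sqr ler_wsqrtr // lerDl sqr_ge0.
Qed.

Lemma normc_ge_absIm (z : R[i]) : `|complex.Im z| <= normc z.
Proof.
by case: z => a b /=; rewrite -sqrtr_sqr ler_wsqrtr // lerDr sqr_ge0.
Qed.

Lemma mxcvg_entries {n} (Z : nat -> 'M[R[i]]_n) (L : 'M[R[i]]_n) :
  (forall j k, (fun m => complex.Re (Z m j k)) @ \oo --> complex.Re (L j k)) ->
  (forall j k, (fun m => complex.Im (Z m j k)) @ \oo --> complex.Im (L j k)) ->
  mxcvg Z L.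
Proof.
move=> cvRe cvIm.
pose bnd m := \sum_j \sum_k (`|complex.Re (Z m j k) - complex.Re (L j k)|
                           + `|complex.Im (Z m j k) - complex.Im (L j k)|).
have bnd0 : bnd m @[m --> \oo] --> (0 : R).
  have dist0 (u : R^nat) l : u @ \oo --> l -> `|u m - l| @[m --> \oo] --> (0 : R).
    by move=> ul; apply/norm_cvg0P; apply/subr_cvg0.
  have -> : (0 : R) = \sum_(j < n) \sum_(k < n) (0 + 0).
    by rewrite big1 // => j _; rewrite big1 // => k _; rewrite addr0.
  apply: cvg_big => [|j _]; first exact: add_continuous.
  apply: cvg_big => [|k _]; first exact: add_continuous.
  by apply: cvgD; apply: dist0; [exact: cvRe|exact: cvIm].
apply: (@squeeze_cvgr _ _ _ _ (cst 0) bnd) => //; last exact: cvg_cst.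
apply: nearW => m; rewrite /= specnorm_ge0 /=.
apply: le_trans (specnorm_sum_entries _) _.
apply: ler_sum => j _; apply: ler_sum => k _.
by apply: le_trans (normc_le _) _; rewrite !mxE !raddfB.
Qed.

(** Real and imaginary parts of every entry inherit the geometric bound on increments, so each
    converges in [R]. Orbits of a contraction supply such a bound. *)
Lemma specnorm_complete {n} (Z : nat -> 'M[R[i]]_n) (C q : R) : 0 <= q < 1 ->
  (forall m, specnorm (Z m.+1 - Z m) <= C * q ^+ m) -> exists L, mxcvg Z L.
Proof.
move=> q01 ZC.
have ReIm m j k : `|complex.Re (Z m.+1 j k) - complex.Re (Z m j k)| <= C * q ^+ m /\
    `|complex.Im (Z m.+1 j k) - complex.Im (Z m j k)| <= C * q ^+ m.
  have := le_trans (normc_entry (Z m.+1 - Z m) j k) (ZC m).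
  rewrite !mxE => zC; rewrite -!raddfB; split.
    exact: le_trans (normc_ge_absRe _) zC.
  exact: le_trans (normc_ge_absIm _) zC.
have cRe j k : cvgn (fun m => complex.Re (Z m j k)).
  by apply: (@geometric_increments_cvg _ C q) => // m; have [] := ReIm m j k.
have cIm j k : cvgn (fun m => complex.Im (Z m j k)).
  by apply: (@geometric_increments_cvg _ C q) => // m; have [] := ReIm m j k.
exists (\matrix_(j, k) (limn (fun m => complex.Re (Z m j k))
                     +i* limn (fun m => complex.Im (Z m j k)))).
by apply: mxcvg_entries => j k; rewrite mxE.
Qed.

(** Closed balls are closed under limits: let [m] grow in [|L - A| <= r + |Z m - L|]. *)
Lemma mxcvg_le {n} (Z : nat -> 'M[R[i]]_n) (L A : 'M[R[i]]_n) r :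
  mxcvg Z L -> (forall m, specnorm (Z m - A) <= r) -> specnorm (L - A) <= r.
Proof.
move=> ZL Zr; rewrite -[leRHS]addr0.
have : (fun m => r + specnorm (Z m - L)) @ \oo --> r + (0 : R).
  by apply: cvgD => //; exact: cvg_cst.
move=> lim; rewrite -(cvg_lim _ lim) //.
apply: limr_ge; first by apply/cvg_ex; exists (r + 0).
apply: nearW => m; apply: le_trans (specnorm_triangle (Z m) _ _) _.
by rewrite addrC (specnorm_sub L); exact: lerD (Zr m) (lexx _).
Qed.

End Completeness.

(** * Banach's fixed point argument on a closed ball *)

Section Contraction.
Context {R : realType} {n : nat}.
Variables (f : 'M[R[i]]_n -> 'M[R[i]]_n) (A : 'M[R[i]]_n) (q r s : R).
Hypotheses (q01 : 0 <= q < 1) (sr : s < r).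
Hypothesis f_ball : forall Z, specnorm (Z - A) <= r -> specnorm (f Z - A) <= s.
Hypothesis f_contr : forall Z W, specnorm (Z - A) <= r -> specnorm (W - A) <= r ->
  specnorm (f Z - f W) <= q * specnorm (Z - W).

Let iter_ball Z k : specnorm (Z - A) <= r -> specnorm (iter k f Z - A) <= r.
Proof.
by move=> Zr; elim: k => [//|k /f_ball fZ]; exact: le_trans fZ (ltW sr).
Qed.

Let iter_contr Z W k : specnorm (Z - A) <= r -> specnorm (W - A) <= r ->
  specnorm (iter k f Z - iter k f W) <= specnorm (Z - W) * q ^+ k.
Proof.
case/andP: q01 => q0 _ Zr Wr; elim: k => [|k IH]; first by rewrite mulr1.
apply: le_trans (f_contr _ _ (iter_ball _ _ Zr) (iter_ball _ _ Wr)) _.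
by rewrite exprS mulrCA ler_wpM2l.
Qed.

Lemma contraction_fixpoint_unique Z W : specnorm (Z - A) <= r -> specnorm (W - A) <= r ->
  f Z = Z -> f W = W -> Z = W.
Proof.
case/andP: q01 => q0 q1 Zr Wr fZ fW; apply/eqP; rewrite -subr_eq0; apply/eqP.
apply: specnorm_eq0; have := f_contr _ _ Zr Wr; rewrite fZ fW.
(* The bound reads [0 <= (q - 1) |Z - W|] with [q - 1 < 0]. *)
by rewrite -subr_ge0 -{2}[specnorm _]mul1r -mulrBl nmulr_rge0 // subr_lt0.
Qed.

Lemma contraction_fixpoint_cvg L Z : specnorm (L - A) <= r -> f L = L -> specnorm (Z - A) <= r ->
  mxcvg (fun k => iter k f Z) L.
Proof.
case/andP: q01 => q0 q1 Lr fL Zr.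
have iterL k : iter k f L = L by elim: k => //= k ->.
apply: (@squeeze_cvgr _ _ _ _ (cst 0) (geometric (specnorm (Z - L)) q)).
- apply: nearW => k; rewrite /= specnorm_ge0 /=.
  by rewrite -{1}(iterL k); exact: iter_contr.
- exact: cvg_cst.
- by apply: cvg_geometric; rewrite ger0_norm.
Qed.

Lemma contraction_fixpoint_exists Z : specnorm (Z - A) <= r ->
  exists2 L, specnorm (L - A) <= r & f L = L.
Proof.
case/andP: (q01) => q0 q1 Zr.
have [L ZL] : exists L, mxcvg (fun k => iter k f Z) L.
  apply: (@specnorm_complete _ _ _ (specnorm (f Z - Z)) q) => // m.
  (* Consecutive iterates of [Z] are the iterates of equal index of [f Z] and [Z], so their distance
     decays like [q ^+ m]. *)
  rewrite iterSr; exact: iter_contr (le_trans (f_ball _ Zr) (ltW sr)) Zr.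
have Lr : specnorm (L - A) <= r by apply: (mxcvg_le _ _ _ _ ZL) => m; exact: iter_ball.
exists L => //; apply/eqP; rewrite -subr_eq0; apply/eqP; apply: specnorm_eq0.
apply: (le_cvg0_le0 (fun k => specnorm (iter k f Z - L)) _ q ZL) => k.
apply: le_trans (specnorm_triangle (iter k.+1 f Z) _ _) _.
rewrite lerD2r specnorm_sub; exact: f_contr (iter_ball _ k Zr) Lr.
Qed.

(** Being a value of [f], the fixed point lies in the smaller ball of radius [s]. The points at
    distance less than [r - s] from it thus stay in the large ball, where the contraction estimates
    hold; this is where the strict inequality [s < r] enters. *)
Lemma contraction_fixpoint_stable L : specnorm (L - A) <= r -> f L = L ->
  asymptotically_stable f L.
Proof.
case/andP: (q01) => q0 q1 Lr fL.
have LA : specnorm (L - A) <= s by rewrite -fL; exact: f_ball.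
have near_ball Z : specnorm (Z - L) < r - s -> specnorm (Z - A) <= r.
  move=> ZL; apply: le_trans (specnorm_triangle L _ _) _.
  by apply: le_trans (lerD (ltW ZL) LA) _; rewrite subrK.
have iterL k : iter k f L = L by elim: k => //= k ->.
split.
  (* The bound [r - s] keeps [Z] in the ball; [e] suffices otherwise, since distances to [L] never
     grow along the orbit. *)
  move=> e e0; exists (Num.min e (r - s)); first by rewrite lt_min e0 subr_gt0.
  move=> Z; rewrite lt_min => /andP[Ze Zrs] k; have Zr := near_ball Z Zrs.
  rewrite -(iterL k); apply: le_lt_trans (iter_contr _ _ k Zr Lr) _.
  by apply: le_lt_trans Ze; rewrite ler_piMr ?specnorm_ge0 ?exprn_ile1 // ltW.
exists (r - s); first by rewrite subr_gt0.
by move=> Z Zrs; exact: contraction_fixpoint_cvg Lr fL (near_ball Z Zrs).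
Qed.

End Contraction.

(** * Algebraic form of the difference of two values of the map *)

Section IterativeMapDifference.
Context {K : fieldType} {n : nat}.
Implicit Types A B C D Delta Z W : 'M[K]_n.

Lemma hadamardBr A B C : hadamard A (B - C) = hadamard A B - hadamard A C.
Proof. by apply/matrixP => j k; rewrite !mxE mulrBr. Qed.

Lemma diag_partB A B : diag_part (A - B) = diag_part A - diag_part B.
Proof. by apply/matrixP => j k; rewrite !mxE mulrnBl. Qed.

Lemma iter_mapB D Delta Z W : iter_map D Delta Z - iter_map D Delta W =
  hadamard (inverse_gaps D) ((Z - W) *m diag_part (Delta *m Z)
    + (W *m diag_part (Delta *m (Z - W)) - Delta *m (Z - W))).
Proof.
(* Here [x] stands for the mixed term [W *m diag_part (Delta *m Z)], inserted to split the quadratic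
   part into two pieces, each linear in [Z - W]. *)
have rearrange (a b c d x : 'M[K]_n) :
    a - b - (c - d) = a - x + (x - c - (b - d)).
  by rewrite opprD addrACA -opprD addrA subrKA.
rewrite /iter_map opprD addrACA subrr add0r -hadamardBr; congr hadamard.
by rewrite mulmxBl !mulmxBr diag_partB mulmxBr.
Qed.

End IterativeMapDifference.

(** * Norm estimates for the map on a ball around the identity *)

Section IterativeMap.
Context {R : realType} {n : nat}.
Variables (D Delta : 'M[R[i]]_n).
Local Notation G := (inverse_gaps D).
Local Notation F := (iter_map D Delta).
Local Notation eps := (specnorm G * specnorm Delta).

Lemma specnorm_le_add1 (r : R) (Z : 'M[R[i]]_n) :
  specnorm (Z - 1%:M) <= r -> specnorm Z <= 1 + r.
Proof.
move=> Zr; rewrite -(subrK 1%:M Z) addrC.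
by apply: le_trans (specnormD _ _) _; exact: lerD specnorm1 Zr.
Qed.

Lemma specnorm_diag_partM Z : specnorm (diag_part (Delta *m Z)) <= specnorm Delta * specnorm Z.
Proof. exact: le_trans (specnorm_diag_part _) (specnormM _ _). Qed.

(** Since [|Z| <= 1 + r], the quadratic term contributes [|Delta| (1 + r)^2] and the linear one
    [|Delta| (1 + r)]. *)
Lemma specnorm_iter_map1 (r : R) Z : 0 <= r -> specnorm (Z - 1%:M) <= r ->
  specnorm (F Z - 1%:M) <= eps * ((1 + r) * (2 + r)).
Proof.
move=> r0 /specnorm_le_add1 Zr; rewrite /iter_map [1%:M + _]addrC addrK.
apply: le_trans (specnorm_hadamard _ _) _.
rewrite -mulrA ler_wpM2l ?specnorm_ge0 //.
apply: le_trans (specnormB _ _) _.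
have z0 := specnorm_ge0 Z; have d0 := specnorm_ge0 Delta.
have H1 : specnorm (Z *m diag_part (Delta *m Z)) <= (1 + r) * (specnorm Delta * (1 + r)).
  apply: le_trans (specnormM _ _) _.
  apply: ler_pM; rewrite ?specnorm_ge0 //.
  by apply: le_trans (specnorm_diag_partM _) _; rewrite ler_wpM2l.
have H2 : specnorm (Delta *m Z) <= specnorm Delta * (1 + r).
  by apply: le_trans (specnormM _ _) _; rewrite ler_wpM2l.
by apply: le_trans (lerD H1 H2) _; rewrite le_eqVlt; apply/orP; left; apply/eqP; ring.
Qed.

(** Of the three terms of [iter_mapB], the two quadratic ones contribute a factor [1 + r] each and
    the linear one a factor [1], hence [3 + 2 r]. *)
Lemma specnorm_iter_mapB (r : R) Z W : 0 <= r ->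
  specnorm (Z - 1%:M) <= r -> specnorm (W - 1%:M) <= r ->
  specnorm (F Z - F W) <= eps * (3 + 2 * r) * specnorm (Z - W).
Proof.
move=> r0 /specnorm_le_add1 Zr /specnorm_le_add1 Wr.
rewrite iter_mapB.
apply: le_trans (specnorm_hadamard _ _) _.
rewrite -!mulrA ler_wpM2l ?specnorm_ge0 //.
have d0 := specnorm_ge0 Delta; have zw0 := specnorm_ge0 (Z - W).
set d := specnorm Delta in d0 *; set zw := specnorm (Z - W) in zw0 *.
have H1 : specnorm ((Z - W) *m diag_part (Delta *m Z)) <= zw * (d * (1 + r)).
  apply: le_trans (specnormM _ _) _; rewrite ler_wpM2l //.
  by apply: le_trans (specnorm_diag_partM _) _; rewrite ler_wpM2l.
have H2 : specnorm (W *m diag_part (Delta *m (Z - W))) <= (1 + r) * (d * zw).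
  apply: le_trans (specnormM _ _) _.
  by apply: ler_pM; rewrite ?specnorm_ge0 // specnorm_diag_partM.
apply: le_trans (specnormD _ _) _.
apply: le_trans (lerD H1 (le_trans (specnormB _ _) (lerD H2 (specnormM _ _)))) _.
by rewrite le_eqVlt; apply/orP; left; apply/eqP; rewrite -/d -/zw; ring.
Qed.

End IterativeMap.

(** * The fixed point argument at radius [sqrt 2] *)

Theorem theorem4p1 (R : realType) (n : nat) (M D Delta : 'M[R[i]]_n)
    (hM : M = D + Delta)
    (hD : is_diag_mx D)
    (hgap : forall j k : 'I_n, j != k -> D j j != D k k)
    (hsmall : specnorm (inverse_gaps D) * specnorm Delta
              < 3 - 2 * Num.sqrt (2 : R)) :
  exists Zs : 'M[R[i]]_n,
    [/\ specball 1%:M (Num.sqrt 2) Zs,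
        iter_map D Delta Zs = Zs,
        forall Z : 'M[R[i]]_n,
          specball 1%:M (Num.sqrt 2) Z -> iter_map D Delta Z = Z -> Z = Zs,
        mxcvg (fun k => iter k (iter_map D Delta) 1%:M) Zs &
        asymptotically_stable (iter_map D Delta) Zs].
Proof.
have t0 : 0 <= Num.sqrt (2 : R) by exact: sqrtr_ge0.
have t2 : Num.sqrt (2 : R) ^+ 2 = 2 by rewrite sqr_sqrtr.
set t := Num.sqrt 2 in t0 t2 hsmall *.
have e0 : 0 <= specnorm (inverse_gaps D) * specnorm Delta.
  by rewrite mulr_ge0 ?specnorm_ge0.
set e := _ * _ in hsmall e0.
(* The Lipschitz constant is below [1] because the threshold [3 - 2 t] is the inverse of
   [3 + 2 t]. *)
have q01 : 0 <= e * (3 + 2 * t) < 1.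
  have q1 : (3 - 2 * t) * (3 + 2 * t) = 1.
    by rewrite -subr_sqr exprMn t2; ring.
  have p0 : 0 < 3 + 2 * t by lra.
  by apply/andP; split; [exact: mulr_ge0 e0 (ltW p0)|rewrite -[ltRHS]q1 ltr_pM2r].
have st : e * ((1 + t) * (2 + t)) < t.
  have tE : (3 - 2 * t) * ((1 + t) * (2 + t)) = t.
    (* The expansion keeps [t ^+ 2] visible, so that it can be replaced by [2]; what remains is
       [6 + 5 t - 6 - 4 t]. *)
    transitivity (6 + 5 * t - 3 * t ^+ 2 - 2 * t * t ^+ 2); first by ring.
    by rewrite t2; ring.
  by rewrite -[ltRHS]tE ltr_pM2r // mulr_gt0 //; lra.
have F_ball Z := @specnorm_iter_map1 _ _ D Delta t Z t0.
have F_contr Z W := @specnorm_iter_mapB _ _ D Delta t Z W t0.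
have I_ball : specnorm (1%:M - 1%:M : 'M[R[i]]_n) <= t by rewrite subrr specnorm0.
have [L Lt FL] := contraction_fixpoint_exists _ _ _ _ _ q01 st F_ball F_contr _ I_ball.
exists L; split.
- exact: Lt.
- exact: FL.
- move=> Z Zt FZ.
  exact: (contraction_fixpoint_unique _ _ _ _ q01 F_contr _ _ Zt Lt FZ FL).
- exact: (contraction_fixpoint_cvg _ _ _ _ _ q01 st F_ball F_contr _ _ Lt FL I_ball).
- exact: (contraction_fixpoint_stable _ _ _ _ _ q01 st F_ball F_contr _ Lt FL).
Qed.
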